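(* Let $m\ge2$ be an integer, let $a$ be real, and let $F_m$ be a real polynomial of degree $m$ with $F_m(0)=1$ whose zeros are real and equal to $-\alpha_1,\ldots,-\alpha_m$ (repeated according to multiplicity). (i) If $\alpha_j<a<1-m$ for $j=1,\ldots,m$, then all zeros of the polynomial $\hat{w}(a;F_m\,|\,x)$ are real and lie in the interval $(1,\infty)$. (ii) If $1-m<a<2-m$ and $\alpha_j<a$ for $j=1,\ldots,m$, then all zeros of $\hat{w}(a;F_m\,|\,x)$ but one lie in $(1,\infty)$, and the one remaining zero lies in $(0,1)$.
   Context: $(a)_n=a(a+1)\cdots(a+n-1)$, $(a)_0=1$, is the Pochhammer symbol. For real $a$ and a polynomial $F_m$ of degree $m$ with $F_m(0)=1$, the $F_m$-Eulerian polynomial $\hat{w}(x)=\hat{w}(a;F_m\,|\,x)$ is the polynomial in $x$ of degree at most $m$ defined by $$\sum_{n=0}^{\infty}F_m(n)\frac{(a)_n}{n!}x^n=\frac{\hat{w}(a;F_m\,|\,x)}{(1-x)^{m+a}},$$ where powers of $1-x$ are understood as power series at $0$. Zeros are counted with multiplicity. *)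

(* Defs.v *)
From HB Require Import structures.
From mathcomp Require Import all_boot all_order all_algebra.
From mathcomp Require Import reals complex ring.

Set Implicit Arguments.
Unset Strict Implicit.
Unset Printing Implicit Defensive.

Import Order.TTheory GRing.Theory Num.Theory.
Local Open Scope ring_scope.
Local Open Scope complex_scope.

Definition poch (R : realType) (a : R) (n : nat) : R :=
  \prod_(i < n) (a + i%:R).

(* Formal power series are given by their coefficient sequences. By the
   binomial series, (1 - x)^s = \sum_k (-s)_k / k! x^k. *)
Definition pow1B_coef (R : realType) (s : R) (k : nat) : R :=
  poch (- s) k / k`!%:R.

(* w = \hat w(a; F | x), with m = deg F = (size F).-1: the second conjunct
   equates the coefficients of x^n in \sum_n F(n) (a)_n / n! x^n and in
   w * (1 - x)^(- (m + a)). *)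
Definition is_eulerian (R : realType) (a : R) (F w : {poly R}) : Prop :=
  (size w <= size F)%N /\
  forall n : nat,
    F.[n%:R] * (poch a n / n`!%:R) =
    \sum_(i < n.+1)
      w`_i * pow1B_coef (- ((size F).-1%:R + a)) (n - i).

(* The complex zeros of p <> 0, listed with multiplicity (in any order). *)
Definition zero_list (R : realType) (p : {poly R}) (s : seq R[i]) : Prop :=
  p != 0 /\
  map_poly (real_complex R) p =
    (lead_coef p)%:C *: \prod_(z <- s) ('X - z%:P).

Section WellDefined.
Variable R : realType.
Implicit Types (a b : R) (F w p q r : {poly R}).

Let B b k : R := poch b k / k`!%:R.
Let P N b : {poly R} := \poly_(k < N) B b k.
Let eqN N p q := forall i, (i < N)%N -> p`_i = q`_i.

Let eqN_mull N r p q : eqN N p q -> eqN N (r * p) (r * q).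
Proof.
move=> h i iN; rewrite !coefM; apply: eq_bigr => j _.
by rewrite h // (leq_ltn_trans (leq_subr _ _)).
Qed.

Let pochS b k : poch b k.+1 = poch b k * (b + k%:R).
Proof. by rewrite /poch big_ord_recr. Qed.

Let pochSl b k : poch b k.+1 = b * poch (b + 1) k.
Proof.
rewrite /poch big_ord_recl addr0; congr (_ * _).
by apply: eq_bigr => i _; rewrite /bump /= natrD addrA.
Qed.

Let B0 b : B b 0 = 1.
Proof. by rewrite /B /poch big_ord0 fact0 divr1. Qed.

Let BS_mul b k : k.+1%:R * B b k.+1 = b * B (b + 1) k.
Proof.
rewrite /B pochSl factS natrM -[k.+1]addn1 natrD.
have h1 : k%:R + 1 != 0 :> R by rewrite -[1]/(1%:R) -natrD addn1 pnatr_eq0.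
have h2 : k`!%:R != 0 :> R by rewrite pnatr_eq0 -lt0n fact_gt0.
by field; rewrite ?h1 ?h2.
Qed.

Let BS_sub b k : B b k.+1 = B (b + 1) k.+1 - B (b + 1) k.
Proof.
rewrite /B pochSl pochS factS natrM -[k.+1]addn1 natrD.
have h1 : k%:R + 1 != 0 :> R by rewrite -[1]/(1%:R) -natrD addn1 pnatr_eq0.
have h2 : k`!%:R != 0 :> R by rewrite pnatr_eq0 -lt0n fact_gt0.
by field; rewrite ?h1 ?h2.
Qed.

Let P_sub N b : eqN N ((1 - 'X) * P N (b + 1)) (P N b).
Proof.
move=> [|i] iN; rewrite mulrBl mul1r coefB coefXM !coef_poly iN /=.
  by rewrite !B0 subr0.
by rewrite (ltnW iN) (BS_sub b).
Qed.

Let P_deriv N b : eqN N ('X * (P N b)^`()) (b *: ('X * P N (b + 1))).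
Proof.
move=> [|i] iN; rewrite coefZ !coefXM /= ?mulr0 //.
by rewrite coef_deriv !coef_poly iN (ltnW iN) -mulr_natl BS_mul.
Qed.

Let conv w b n : \sum_(i < n.+1) w`_i * B b (n - i) = (w * P n.+1 b)`_n.
Proof.
rewrite coefM; apply: eq_bigr => i _.
by rewrite coef_poly ltnS leq_subr.
Qed.

Let step w b n : 
  (('X * (1 - 'X) * w^`() + b *: ('X * w)) * P n.+1 (b + 1))`_n
  = n%:R * (w * P n.+1 b)`_n.
Proof.
have -> : n%:R * (w * P n.+1 b)`_n = ('X * (w * P n.+1 b)^`())`_n.
  by rewrite coefXM coef_deriv; case: n => [|n] /=; rewrite ?mul0r // mulr_natl.
have -> : ('X * (1 - 'X) * w^`() + b *: ('X * w)) * P n.+1 (b + 1) =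
  ('X * w^`()) * ((1 - 'X) * P n.+1 (b + 1)) + w * (b *: ('X * P n.+1 (b + 1))).
  by rewrite -!mul_polyC; ring.
rewrite derivM mulrDr [in RHS]coefD [in LHS]coefD; congr (_ + _).
  by rewrite (@eqN_mull n.+1 _ _ _ (P_sub b)) // mulrA.
rewrite (mulrCA 'X w).
by rewrite -(@eqN_mull n.+1 _ _ _ (P_deriv b)).
Qed.

Let pow1B a m n : ((1 - 'X) ^+ m * P n.+1 (m%:R + a))`_n = B a n.
Proof.
elim: m => [|m IH]; first by rewrite mul1r add0r coef_poly ltnSn.
rewrite exprSr -mulrA -IH -[in LHS](addn1 m) natrD addrAC.
by rewrite (@eqN_mull n.+1 _ _ _ (P_sub _)).
Qed.

Let size_mulP p q k l :
  (size p <= k.+1)%N -> (size q <= l)%N -> (size (p * q)%R <= k + l)%N.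
Proof.
move=> hp hq; apply: leq_trans (size_polyMleq _ _) _.
by rewrite -subn1 leq_subLR addnA add1n leq_add.
Qed.

Let exists_num a F m : (size F <= m.+1)%N ->
  exists2 w : {poly R}, (size w <= m.+1)%N &
    forall n, F.[n%:R] * B a n = (w * P n.+1 (m%:R + a))`_n.
Proof.
elim: m F => [|m IH] F sF.
  exists F => // n; have /size1_polyC -> := sF.
  by rewrite hornerC mul_polyC coefZ coef_poly ltnSn add0r.
elim/poly_ind: F sF => [|G c _] sF.
  by exists 0; rewrite ?size_poly0 // => n; rewrite horner0 !mul0r coef0.
have sG : (size G <= m.+1)%N.
  by move: sF; rewrite size_MXaddC; case: ifP => [/andP[/eqP-> _]|]; rewrite ?size_poly0.
have [w sw hw] := IH G sG.
exists ('X * (1 - 'X) * w^`() + (m%:R + a) *: ('X * w) + c *: (1 - 'X) ^+ m.+1).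
  have s1X : (size (1 - 'X : {poly R})%R <= 2)%N.
    by rewrite -opprB size_polyN size_XsubC.
  rewrite (leq_trans (size_polyD _ _)) // geq_max; apply/andP; split; last first.
    rewrite (leq_trans (size_scale_leq _ _)) //.
    apply: leq_trans (size_poly_exp_leq _ _) _.
    by rewrite ltnS -[leqRHS]mul1n leq_mul2r -subn1 leq_subLR s1X orbT.
  rewrite (leq_trans (size_polyD _ _)) // geq_max; apply/andP; split; last first.
    rewrite (leq_trans (size_scale_leq _ _)) //.
    exact: (size_mulP (eq_leq (size_polyX _))).
  rewrite -mulrA; apply: (size_mulP (eq_leq (size_polyX _))).
  have [->|w0] := eqVneq w 0; first by rewrite deriv0 mulr0 size_poly0.
  by apply: (size_mulP s1X); rewrite -ltnS (leq_trans (lt_size_deriv w0)).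
move=> n; have e : m.+1%:R + a = m%:R + a + 1 by rewrite -natr1 addrAC.
rewrite mulrDl coefD -scalerAl coefZ pow1B e step -hw.
by rewrite hornerD hornerMX hornerC; ring.
Qed.

Lemma is_eulerian_ex_unique a F : F != 0 -> exists! w, is_eulerian a F w.
Proof.
move=> F0; set m := (size F).-1.
have sF : size F = m.+1 by rewrite /m prednK // lt0n size_poly_eq0.
have cB b k : pow1B_coef (- b) k = B b k by rewrite /pow1B_coef opprK.
have [w sw hw] := @exists_num a F m (eq_leq sF).
have hw' : is_eulerian a F w.
  split=> [|n]; first by rewrite sF.
  by rewrite -/(B a n) hw -conv; apply: eq_bigr => i _; rewrite cB.
exists w; split=> // v [_ hv].
apply/polyP => n; elim/ltn_ind: n => n IH.
have := hv n; case: hw' => _ ->.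
rewrite !big_ord_recr /= subnn !cB B0 !mulr1.
under eq_bigr => i _ do rewrite IH //.
by move/addrI.
Qed.

End WellDefined.

(* Main.v *)
Require Import Defs.
From mathcomp Require Import all_boot all_order all_algebra.
From mathcomp Require Import reals complex.
From mathcomp Require Import polyrcf ring lra.
Import Order.TTheory GRing.Theory Num.Theory.
Local Open Scope ring_scope.
Local Open Scope complex_scope.

(** Multiplying the n-th coefficient of a power series by [1 + n / c] amounts
    to applying [1 + c^-1 x d/dx], so the Eulerian polynomial of
    [(1 + X / c) * F], where [F] has degree [k], is
    [v = c^-1 (x (1 - x) w' + ((k + a - c) x + c) w)], where [w] is that of [F]
    ([is_eulerian_next]).  Since [F] is a product of such factors, the Eulerian
    polynomial is built from [1] by these steps, with [c] running over the
    [alpha j].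

    Suppose that [c < a < 0], that [w 0] and [w 1] are positive and that [w] has
    degree [k] and [k] simple zeros, all in [(1, oo)].  At such a zero [x],
    [v x] has the sign of [w' x], because [x (1 - x) / c > 0]; hence, like [w'],
    [v] alternates in sign along the zeros of [w].
    The leading coefficient is multiplied by [(a - c) / c < 0], so there is one
    more sign change between the largest zero of [w] and infinity.  Finally
    [v 1 = (k + a) / c * w 1].  If [k + a < 0], then [v 1] and [w 1] have
    the same sign, which gives a further sign change between [1] and the least
    zero of [w]: thus [v] has [k + 1] simple zeros in [(1, oo)], and induction
    ([eulerian_roots_gt1]) proves the first claim.  If [0 < k + a], which for
    the second claim happens exactly at the last step, then [v 1 < 0 < v 0] and
    [v] has [k] zeros beyond the least zero of [w] and one in [(0, 1)]. *)

(** * The recurrence *)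

(** The numerator obtained from [w] when a polynomial of degree [k] is
    multiplied by [1 + X / c]. *)
Definition eulerian_next {R : realType} (a : R) (k : nat) (c : R)
    (w : {poly R}) : {poly R} :=
  c^-1 *: ('X * (1 - 'X) * w^`() + ((k%:R + a - c) *: 'X + c%:P) * w).

(** The polynomial with value [1] at [0] and with zeros [- c], [c] in [s]
    (for nonzero [c]). *)
Definition unit_prod {R : realType} (s : seq R) : {poly R} :=
  \prod_(c <- s) (c^-1 *: 'X + 1).

Section Recurrence.
Variable R : realType.
Implicit Types (a b c : R) (F w : {poly R}) (s : seq R).

Lemma pow1B_coef0 b : pow1B_coef b 0 = 1.
Proof. by rewrite /pow1B_coef /poch big_ord0 fact0 divr1. Qed.

(** The numbers [pow1B_coef (- b) k] are the coefficients of [(1 - x)^(- b)];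
    this is the derivative of that series. *)
Lemma pow1B_coefS b k :
  k.+1%:R * pow1B_coef (- b) k.+1 = b * pow1B_coef (- (b + 1)) k.
Proof.
rewrite /pow1B_coef !opprK /poch big_ord_recl addr0.
under eq_bigr do rewrite /bump /= natrD addrA.
rewrite factS natrM; set f : R := k`!%:R.
have f0 : f != 0 by rewrite pnatr_eq0 -lt0n fact_gt0.
have h : k.+1%:R != 0 :> R by rewrite pnatr_eq0.
by move: h; rewrite -natr1 => h; field; rewrite f0 h.
Qed.

Lemma pow1B_coef_pascal b k :
  pow1B_coef (- (b + 1)) k.+1 =
  pow1B_coef (- b) k.+1 + pow1B_coef (- (b + 1)) k.
Proof.
have h : k.+1%:R != 0 :> R by rewrite pnatr_eq0.
apply: (mulfI h); rewrite mulrDr (pow1B_coefS b k) -mulrDl.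
rewrite /pow1B_coef opprK /poch big_ord_recr /= factS natrM.
set f : R := k`!%:R; have f0 : f != 0 by rewrite pnatr_eq0 -lt0n fact_gt0.
by move: h; rewrite -natr1 => h; field; rewrite f0 h.
Qed.

Lemma coef_eulerian_next a k c w i : c != 0 ->
  (eulerian_next a k c w)`_i =
  c^-1 * ((i%:R + c) * w`_i +
          (if i is j.+1 then (k%:R + a - c - j%:R) * w`_j else 0)).
Proof.
move=> c0; rewrite /eulerian_next coefZ; congr (_ * _).
rewrite -mulrA mulrBl mul1r mulrBr mulrDl -scalerAl mul_polyC.
rewrite !(coefD, coefN, coefZ, coefXM, coef_deriv).
case: i => [|[|j]] /=; first by ring.
  by ring.
by rewrite -![w`_ _ *+ _]mulr_natl -!natr1; ring.
Qed.

Lemma eulerian_next0 a k c w : c != 0 -> (eulerian_next a k c w).[0] = w.[0].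
Proof.
by move=> c0; rewrite /eulerian_next !hornerE /= mulVf ?mul1r.
Qed.

Lemma eulerian_next1 a k c w :
  (eulerian_next a k c w).[1] = (k%:R + a) / c * w.[1].
Proof. by rewrite /eulerian_next !hornerE; ring. Qed.

Lemma eulerian_next_root a k c w x : root w x ->
  (eulerian_next a k c w).[x] = x * (1 - x) / c * w^`().[x].
Proof.
by move=> /rootP wx; rewrite /eulerian_next !hornerE wx; ring.
Qed.

Lemma size_eulerian_next a k c w : c < a -> c != 0 -> size w = k.+1 ->
  size (eulerian_next a k c w) = k.+2 /\
  lead_coef (eulerian_next a k c w) = (a - c) / c * lead_coef w.
Proof.
move=> ca c0 sw.
have le: (eulerian_next a k c w)`_k.+1 = (a - c) / c * lead_coef w.
  rewrite coef_eulerian_next // lead_coefE sw /= [w`_k.+1]nth_default ?sw //.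
  by ring.
have sv : size (eulerian_next a k c w) = k.+2.
  apply/eqP; rewrite eqn_leq; apply/andP; split.
    apply/leq_sizeP => -[//|j] kj; rewrite coef_eulerian_next //.
    by rewrite !nth_default ?sw ?ltnS // ?mulr0 ?addr0 ?mulr0 // ltnW.
  rewrite ltnNge; apply/negP => /leq_sizeP /(_ _ (leqnn _)) /eqP.
  rewrite le !mulf_eq0 invr_eq0 subr_eq0 lead_coef_eq0 -size_poly_eq0 sw.
  by rewrite (gt_eqF ca) (negbTE c0).
by split=> //; rewrite lead_coefE sv.
Qed.

(** With [b = k + a] and [B_b] the coefficients of [(1 - x)^(- b)], this follows
    from [(n + c) B_b(d + 1) = (i + c) B_{b+1}(d + 1) + (b - c - i) B_{b+1}(d)],
    where [n = i + d + 1]. *)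
Lemma is_eulerian_next a k c F w : c != 0 -> size F = k.+1 -> size w = k.+1 ->
  c < a -> is_eulerian a F w ->
  is_eulerian a ((c^-1 *: 'X + 1) * F) (eulerian_next a k c w).
Proof.
move=> c0 sF sw ca [_ hw].
have s1 : size (c^-1 *: 'X + 1 : {poly R}) = 2.
  by rewrite size_polyDl size_scale ?invr_eq0 // size_polyX ?size_poly1.
have sP : size ((c^-1 *: 'X + 1) * F) = k.+2.
  by rewrite size_mul ?s1 ?sF // -size_poly_eq0 ?s1 ?sF.
split=> [|n]; first by rewrite sP (size_eulerian_next _ _ _ _ ca c0 sw).1.
rewrite hornerM -mulrA hw sP sF /= !hornerE.
set b := k%:R + a; have -> : k.+1%:R + a = b + 1 by rewrite -natr1 /b; ring.
under [RHS]eq_bigr do rewrite coef_eulerian_next // -mulrA.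
rewrite -mulr_sumr.
have -> : c^-1 * n%:R + 1 = c^-1 * (n%:R + c) by rewrite mulrDr mulVf.
rewrite -mulrA; congr (_ * _).
under [RHS]eq_bigr do rewrite mulrDl.
rewrite big_split /= big_ord_recr [X in _ = _ + X]big_ord_recl /=.
rewrite big_ord_recr /= !subnn !pow1B_coef0 !mulr1 mul0r add0r mulrDr.
rewrite addrAC -big_split mulr_sumr /=; congr (_ + _).
apply: eq_bigr => i _; rewrite /bump /= add1n.
have en : n = (i + (n - i.+1).+1)%N.
  by rewrite subnSK ?ltn_ord // subnKC // ltnW.
rewrite -(subnSK (ltn_ord i)) [in n%:R]en natrD.
move: (n - i.+1)%N => d; have e1 := pow1B_coefS b d.
rewrite pow1B_coef_pascal.
transitivity (w`_i * ((i%:R + c) * pow1B_coef (- b) d.+1 +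
                d.+1%:R * pow1B_coef (- b) d.+1)); first by ring.
by rewrite e1 /b; ring.
Qed.

Lemma is_eulerian1 a : is_eulerian a 1 1.
Proof.
split=> // n; rewrite big_ord_recl big1 => [|i _]; last first.
  by rewrite coefC /= mul0r.
rewrite subn0 coefC /= addr0 mul1r size_poly1 add0r /pow1B_coef opprK.
by rewrite hornerC mul1r.
Qed.

Lemma size_unit_prod s : 0 \notin s -> size (unit_prod s) = (size s).+1.
Proof.
elim: s => [|c s IH]; first by rewrite /unit_prod big_nil size_poly1.
rewrite inE negb_or eq_sym => /andP[c0 /IH ss].
have s1 : size (c^-1 *: 'X + 1 : {poly R}) = 2.
  by rewrite size_polyDl size_scale ?invr_eq0 // size_polyX ?size_poly1.
by rewrite /unit_prod big_cons size_mul ?s1 ?[size _]ss // -size_poly_eq0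
  ?s1 ?[size _]ss.
Qed.

End Recurrence.

(** * Sign changes and zeros *)

(** The values of [f] along [s] are nonzero and alternate in sign, the first one
    having the sign of [e]. *)
Fixpoint alternates {R : realType} (f : R -> R) (e : R) (s : seq R) : bool :=
  if s is x :: s' then (0 < e * f x) && alternates f (- e) s' else true.

Section SignChanges.
Variable R : realType.
Implicit Types (e x y : R) (p : {poly R}) (s r : seq R).

(** The product has the sign of [(-1) ^ size s]. *)
Lemma alternates_rcons (f : R -> R) e s y :
  {in s, forall x, y < x} -> alternates f e s ->
  0 < e * (\prod_(x <- s) (y - x)) * f y -> alternates f e (rcons s y).
Proof.
elim: s e => [|x s IH] e ys /=; first by rewrite big_nil mulr1 => _ ->.
move=> /andP[-> alt]; rewrite big_cons => h.
apply: IH => [z zs|//|]; first by rewrite ys // inE zs orbT.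
have xy : 0 < x - y by rewrite subr_gt0 ys // inE eqxx.
by rewrite -(pmulr_rgt0 _ xy); move: h; congr (_ < _); ring.
Qed.

Lemma alternates_eq_sign (f g : R -> R) d e s : alternates g e s ->
  {in s, forall x, exists2 t, 0 < t & d * f x = t * (e * g x)} ->
  alternates f d s.
Proof.
elim: s d e => //= x s IH d e /andP[gx alt] h; apply/andP; split.
  by have [t t0 ->] := h x (mem_head _ _); rewrite mulr_gt0.
apply: IH alt _ => z zs; have [|t t0 ht] := h z; first by rewrite inE zs orbT.
by exists t => //; rewrite !mulNr ht mulrN.
Qed.

Lemma gt_sorted_cons x s : sorted >%R (x :: s) ->
  sorted >%R s /\ {in s, forall z, z < x}.
Proof.
rewrite /= (path_sortedE (rev_trans lt_trans)) => /andP[/allP h ->].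
by split.
Qed.

(** As [s] is decreasing, the derivative is positive at the head of [s]. *)
Lemma alternates_deriv s : sorted >%R s ->
  alternates (horner (\prod_(z <- s) ('X - z%:P))^`()) 1 s.
Proof.
elim: s => // x s IH /gt_sorted_cons[ss xs].
rewrite big_cons derivM derivXsubC mul1r /=; apply/andP; split.
  rewrite !hornerE subrr mul0r addr0 horner_prod big_seq.
  by apply: prodr_gt0 => z zs; rewrite !hornerE subr_gt0 xs.
apply: alternates_eq_sign (IH ss) _ => z zs.
exists (x - z); first by rewrite subr_gt0 xs.
have /rootP rz : root (\prod_(y <- s) ('X - y%:P)) z by rewrite root_prod_XsubC.
by rewrite hornerD hornerM hornerXsubC rz add0r mulNr !mul1r -mulNr opprB.
Qed.

Lemma sign_at_infinity p e x : 0 < e * lead_coef p ->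
  exists2 y, x < y & 0 < e * p.[y].
Proof.
rewrite -lead_coefZ => h; have [n hn] := poly_pinfty_gt_lc h.
exists (Num.max n (x + 1)); first by rewrite lt_max ltrDl ltr01 orbT.
by rewrite -hornerZ; apply: lt_le_trans h (hn _ _); rewrite le_max lexx.
Qed.

(** Intermediate value theorem between consecutive points: one zero in each
    gap, so they are distinct and above the last point of [s]. *)
Lemma alternates_roots p e x s : path >%R x s ->
  alternates (horner p) e (x :: s) ->
  exists r, [/\ path >%R x r, size r = size s, all (root p) r &
                all (> last x s) r].
Proof.
elim: s x e => [|y s IH] x e /=; first by exists [::].
move=> /andP[yx ys] /and3P[px py alt].
have [|r [pr sr rr lr]] := IH y (- e) ys; first by rewrite /= py.
have [|z zxy rz] := @poly_ivtoo _ p y x (ltW yx).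
  have : 0 < (- e * p.[y]) * (e * p.[x]) by rewrite mulr_gt0.
  have -> : - e * p.[y] * (e * p.[x]) = e ^+ 2 * - (p.[y] * p.[x]) by ring.
  have e0 : 0 < e ^+ 2.
    rewrite exprn_even_gt0 //=; apply: contraTneq px => ->.
    by rewrite mul0r ltxx.
  by rewrite pmulr_rgt0 // oppr_gt0.
have /andP[yz zx] : y < z < x by move: zxy; rewrite in_itv.
exists (z :: r); split=> //=; rewrite ?sr ?rz ?rr ?lr ?andbT //.
  rewrite zx /=; case: r pr {sr rr lr} => //= t r /andP[ty ->].
  by rewrite (lt_trans ty).
apply: le_lt_trans yz.
by move: ys; rewrite (path_sortedE (rev_trans lt_trans)) => /andP[/allP h _];
  case/predU1P: (mem_last y s) => [->//|/h/ltW].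
Qed.

Lemma gt_sorted_uniq s : sorted >%R s -> uniq s.
Proof.
by apply: (sorted_uniq (rev_trans lt_trans)) => x; rewrite ltxx.
Qed.

Lemma uniq_prod_roots p s : uniq s -> size p = (size s).+1 ->
  all (root p) s -> p = lead_coef p *: \prod_(z <- s) ('X - z%:P).
Proof.
by move=> us sp rs; apply: all_roots_prod_XsubC; rewrite ?uniq_rootsE.
Qed.

Lemma size_eq_roots p s : p != 0 ->
  p = lead_coef p *: \prod_(z <- s) ('X - z%:P) -> size p = (size s).+1.
Proof.
by move=> p0 ->; rewrite size_scale ?lead_coef_eq0 // size_prod_XsubC.
Qed.

End SignChanges.

(** * The zeros of Eulerian polynomials *)

Section EulerianRoots.
Variable R : realType.
Implicit Types (a b c : R) (F w : {poly R}) (s r : seq R).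

(** The sign changes of [eulerian_next a k c w] along the zeros [r] of [w] and a
    point [M] beyond them; they do not depend on the sign of [k + a]. *)
Lemma eulerian_next_alternates a k c w r : c < a -> c < 0 ->
  size w = k.+1 -> w = lead_coef w *: \prod_(z <- r) ('X - z%:P) ->
  sorted >%R r -> {in r, forall x, 1 < x} ->
  exists M, [/\ 1 < M, path >%R M r &
    alternates (horner (eulerian_next a k c w)) (- lead_coef w) (M :: r)].
Proof.
move=> ca c0 sw wr sr r1; set d := lead_coef w.
have d0 : d != 0 by rewrite lead_coef_eq0 -size_poly_eq0 sw.
have d2 : 0 < d ^+ 2 by rewrite exprn_even_gt0.
have [_ lv] := size_eulerian_next _ _ _ _ _ ca (ltr0_neq0 c0) sw.
have [|M hM vM] := @sign_at_infinity R (eulerian_next a k c w) (- d)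
   (Num.max 1 (head 1 r)).
  rewrite lv -/d; have -> : - d * ((a - c) / c * d) = d ^+ 2 * (a - c) / - c.
    by field; rewrite lt_eqF.
  by rewrite divr_gt0 ?oppr_gt0 // mulr_gt0 // subr_gt0.
move: hM; rewrite gt_max => /andP[M1 Mr]; exists M; split=> //.
  by case: r sr Mr {wr r1} => //= x r -> ->.
apply/andP; split=> //; rewrite opprK.
apply: alternates_eq_sign (alternates_deriv _ _ sr) _ => x xr.
have x1 := r1 _ xr; have x0 : 0 < x := lt_trans ltr01 x1.
exists (d ^+ 2 * (x * (x - 1)) / - c).
  by rewrite divr_gt0 ?oppr_gt0 // mulr_gt0 // mulr_gt0 // subr_gt0.
rewrite eulerian_next_root; last by rewrite wr rootZ // root_prod_XsubC.
by rewrite [in w^`()]wr derivZ hornerZ -/d; field; rewrite lt_eqF.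
Qed.

(** The induction: all zeros are simple and in [(1, oo)]; the values at [0] and
    [1] are what the step to the next factor needs. *)
Lemma eulerian_roots_gt1 a s : all (< a) s -> a < 1 - (size s)%:R ->
  exists w r, [/\ is_eulerian a (unit_prod s) w, size w = (size s).+1,
    w = lead_coef w *: \prod_(z <- r) ('X - z%:P), sorted >%R r &
    [/\ {in r, forall x, 1 < x}, w.[0] = 1 & 0 < w.[1]]].
Proof.
elim: s => [_ _|c s IH /= /andP[ca sa]].
  exists 1, [::]; rewrite /unit_prod !big_nil lead_coef1 scale1r size_poly1.
  by rewrite !hornerC; split=> //; first exact: is_eulerian1.
rewrite -natr1 => ha.
have [|w [r [ew sw wr sr [r1 w0 w1]]]] := IH sa; first by lra.
have ka : (size s)%:R + a < 0 by lra.
have c0 : c < 0 by apply: lt_trans ca _; have := ler0n R (size s); lra.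
have cN0 := ltr0_neq0 c0.
have s0 : 0 \notin s.
  apply/negP => /(allP sa) a_gt0; have := lt_trans a_gt0 ha.
  by have := ler0n R (size s); lra.
set v := eulerian_next a (size s) c w.
have [sv _] := size_eulerian_next _ _ _ _ _ ca cN0 sw.
have v1 : 0 < v.[1].
  by rewrite eulerian_next1 mulr_gt0 // nmulr_rgt0 // invr_lt0.
have [M [M1 Mr alt]] := eulerian_next_alternates _ _ _ _ _ ca c0 sw wr sr r1.
have M1r : {in M :: r, forall x, 1 < x}.
  by move=> x; rewrite inE => /predU1P[->|/r1].
(* Since [w 1] and [v 1] are positive, [1] continues the alternation. *)
have [||t [Mt st rt t1]] := @alternates_roots R v (- lead_coef w) M (rcons r 1).
- by rewrite rcons_path Mr; apply: M1r; apply: mem_last.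
- rewrite -rcons_cons; apply: alternates_rcons => //.
  rewrite big_cons.
  have -> : - lead_coef w * ((1 - M) * (\prod_(x <- r) (1 - x))) =
    (M - 1) * w.[1].
    rewrite [in w.[1]]wr hornerZ horner_prod.
    by under [in RHS]eq_bigr do rewrite hornerXsubC; ring.
  by rewrite !mulr_gt0 // subr_gt0.
exists v, t; rewrite eulerian_next0 // /unit_prod big_cons; split=> //.
- by apply: is_eulerian_next => //; rewrite size_unit_prod.
- apply: uniq_prod_roots; rewrite ?(gt_sorted_uniq _ _ (path_sorted Mt)) //.
  by rewrite /v sv st size_rcons -(size_eq_roots _ _ _ _ wr) ?sw //
    -size_poly_eq0 sw.
- exact: path_sorted Mt.
by split=> // x /(allP t1); rewrite last_rcons.
Qed.

(** A list of real zeros can be checked over the reals. *)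
Lemma zero_listP w (r : seq R) :
  zero_list w [seq x%:C | x <- r] <->
  w != 0 /\ w = lead_coef w *: \prod_(z <- r) ('X - z%:P).
Proof.
have e : \prod_(z <- [seq x%:C | x <- r]) ('X - z%:P) =
    map_poly (real_complex R) (\prod_(z <- r) ('X - z%:P)).
  rewrite rmorph_prod big_map; apply: eq_bigr => z _.
  by rewrite /= map_polyXsubC.
rewrite /zero_list e -map_polyZ; split=> -[w0 h]; split=> //.
  exact: map_poly_inj h.
by rewrite [in LHS]h.
Qed.

(** Normalization at [0] determines the leading coefficient. *)
Lemma unit_prodE F s : 0 \notin s -> F.[0] = 1 ->
  F = lead_coef F *: \prod_(c <- s) ('X + c%:P) -> F = unit_prod s.
Proof.
move=> s0 F0 hF.
have e : unit_prod s = \prod_(c <- s) c^-1 *: \prod_(c <- s) ('X + c%:P).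
  rewrite /unit_prod -scaler_prod !big_seq; apply: eq_bigr => c cs.
  have c0 : c != 0 by apply: contraNneq s0 => <-.
  by rewrite scalerDr -[_ *: c%:P]mul_polyC -polyCM mulVf.
rewrite hF e; congr (_ *: _).
have p0 : \prod_(c <- s) c != 0.
  rewrite prodf_seq_neq0; apply/allP => c cs.
  by apply: contraNneq s0 => <-.
apply: (mulIf p0).
rewrite -big_split /= [RHS]big_seq [RHS]big1 => [|c cs]; last first.
  by rewrite mulVf //; apply: contraNneq s0 => <-.
apply: etrans F0; rewrite [in RHS]hF hornerZ horner_prod; congr (_ * _).
by apply: eq_bigr => c _; rewrite !hornerE.
Qed.

End EulerianRoots.

Theorem theorem4 (R : realType) (m : nat) (hm : (2 <= m)%N) (a : R)
    (F : {poly R}) (hdeg : size F = m.+1) (hF0 : F.[0] = 1)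
    (alpha : 'I_m -> R)
    (hzeros : zero_list F [seq (- alpha j)%:C | j <- enum 'I_m])
    (w : {poly R}) (hw : is_eulerian a F w) :
  ((forall j : 'I_m, alpha j < a) -> a < 1 - m%:R ->
     exists s : seq R,
       zero_list w [seq x%:C | x <- s] /\ (forall x, x \in s -> 1 < x)) /\
  (1 - m%:R < a -> a < 2 - m%:R -> (forall j : 'I_m, alpha j < a) ->
     exists (x0 : R) (s : seq R),
       zero_list w [seq x%:C | x <- x0 :: s] /\
       (0 < x0 < 1) /\ (forall x, x \in s -> 1 < x)).
Proof.
have m2 : 2 <= m%:R :> R by rewrite ler_nat.
set s := [seq alpha j | j <- enum 'I_m].
have ss : size s = m by rewrite size_map size_enum_ord.
have F0 : F != 0 by rewrite -size_poly_eq0 hdeg.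
have uniq w' : is_eulerian a F w' -> w' = w.
  have [v [_ hv]] := @is_eulerian_ex_unique R a F F0.
  by rewrite -(hv w) // => /hv.
have eF : (forall j, alpha j < a) -> a < 0 -> F = unit_prod s.
  move=> ha a0; apply: unit_prodE => //.
    apply/mapP => -[j _ e]; have := ha j; lra.
  move: hzeros; rewrite (map_comp (fun x : R => x%:C)) zero_listP => -[_ {1}->].
  rewrite !big_map; congr (_ *: _); apply: eq_bigr => j _.
  by rewrite polyCN opprK.
have sa : (forall j, alpha j < a) -> all (< a) s.
  by move=> ha; apply/allP => _ /mapP[j _ ->]; exact: ha.
split=> [ha am|am1 am2 ha].
  have [|v [r [ev sv vr _ [r1 _ _]]]] := @eulerian_roots_gt1 R a s (sa ha).
    by rewrite ss.
  have e : v = w by apply: uniq; rewrite eF //; lra.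
  by exists r; split=> //; apply/zero_listP; rewrite -e -size_poly_eq0 sv.
have a0 : a < 0 by lra.
(* The last factor is treated apart: [0 < k + a] for it, with [k = m - 1]. *)
have := sa ha; have := eF ha a0; have := ss.
case: s {ss sa eF} => [|c s /= [ss] eF /andP[ca sa]].
  by move=> /= m0; rewrite -m0 in hm.
have em : m%:R = (size s)%:R + 1 :> R by rewrite natr1 ss.
have [|u [r [eu su ur sr [r1 u0 u1]]]] := @eulerian_roots_gt1 R a s sa.
  by lra.
have c0 : c < 0 := lt_trans ca a0; have cN0 := ltr0_neq0 c0.
have s0 : 0 \notin s by apply/negP => /(allP sa) /(lt_trans a0); rewrite ltxx.
have e : eulerian_next a (size s) c u = w.
  apply: uniq; rewrite eF /unit_prod big_cons; apply: is_eulerian_next => //.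
  by rewrite size_unit_prod.
have [sw _] := size_eulerian_next _ _ _ _ _ ca cN0 su.
have w0 : w.[0] = 1 by rewrite -e eulerian_next0.
have w1 : w.[1] < 0.
  rewrite -e eulerian_next1 pmulr_llt0 // ltr_ndivrMr // mul0r; lra.
have [M [M1 Mr alt]] := eulerian_next_alternates _ _ _ _ _ _ ca c0 su ur sr r1.
have [t [Mt st rt t1]] := alternates_roots _ _ _ _ _ Mr alt.
(* The sign changes beyond [1] give [m - 1] zeros, and [w 1 < 0 < w 0]. *)
have [|x x01 rx] := @poly_ivtoo _ w 0 1 ler01; first by rewrite w0 mul1r.
have t1' y : y \in t -> 1 < y.
  move/(allP t1) => /= /(lt_trans _); apply.
  by case/predU1P: (mem_last M r) => [->//|/r1].
rewrite in_itv /= in x01.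
exists x, t; split; last by split.
apply: (proj2 (zero_listP _ _ (x :: t))); split.
  by rewrite -e -size_poly_eq0 sw.
rewrite -e in rx *; apply: uniq_prod_roots.
- rewrite cons_uniq (gt_sorted_uniq _ _ (path_sorted Mt)) andbT.
  by apply/negP => /t1' /lt_trans /(_ (proj2 (andP x01))); rewrite ltxx.
- by rewrite sw /= st -(size_eq_roots _ _ _ _ ur) ?su // -size_poly_eq0 su.
by rewrite /= rx.
Qed.
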